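(* Let $\mathcal{X}$ be a real Hilbert space, let $D\subseteq\mathcal{X}$ be a nonempty compact convex set, and let $f:\mathcal{X}\to\mathbb{R}$ be convex and differentiable over $D$ with finite curvature constant $C_f$ with respect to $D$. Let $\varepsilon>0$ and $K:=\left\lceil\frac{4C_f}{\varepsilon}\right\rceil$. Run the exact variant of the algorithm ''Greedy on a Convex Set'' for $K$ iterations with step-sizes $\alpha^{(k)}:=\frac{2}{k+2}$ for $0\le k\le K$, and then continue for another $K+1$ iterations with the fixed step-size $\alpha^{(k)}:=\frac{2}{K+2}$ for $K\le k\le 2K+1$. Then the algorithm has an iterate $x^{(\hat k)}$, $K\le\hat k\le 2K+1$, with duality gap bounded by $$g(x^{(\hat k)})\le\varepsilon.$$ The same statement holds for the approximate variant of the algorithm, when setting $K:=\left\lceil\frac{8C_f}{\varepsilon}\right\rceil$ instead.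
   Context: Compact means closed and bounded. The inner product of $\mathcal{X}$ is $\langle\cdot,\cdot\rangle$, and $\nabla f(x)\in\mathcal{X}$ is the gradient of $f$ at $x$. Curvature constant of $f$ with respect to $D$: $$C_f:=\sup_{\substack{x,s\in D,\ \alpha\in(0,1],\\ y=x+\alpha(s-x)}}\frac{1}{\alpha^2}\bigl(f(y)-f(x)-\langle y-x,\nabla f(x)\rangle\bigr).$$ Duality gap at $x\in D$: $g(x):=\max_{y\in D}\langle x-y,\nabla f(x)\rangle$. Algorithm ''Greedy on a Convex Set'' with step-sizes $\alpha^{(k)}$: pick an arbitrary starting point $x^{(0)}\in D$. In iteration $k=0,1,2,\dots$: choose a point $s\in D$ as specified below and set $x^{(k+1)}:=x^{(k)}+\alpha^{(k)}(s-x^{(k)})$. Exact variant: $s\in D$ is any point with $\langle s,\nabla f(x^{(k)})\rangle=\min_{y\in D}\langle y,\nabla f(x^{(k)})\rangle$. Approximate variant: $s\in D$ is any point with $\langle s,\nabla f(x^{(k)})\rangle\le\min_{y\in D}\langle y,\nabla f(x^{(k)})\rangle+\alpha^{(k)}C_f$. (The two step-size prescriptions agree at $k=K$.) *)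

(* Defs.v *)
From mathcomp Require Export all_boot all_order all_algebra.
From mathcomp Require Export all_classical all_reals all_analysis.
Export Order.TTheory GRing.Theory Num.Theory.
Export numFieldNormedType.Exports.

Set Implicit Arguments.
Unset Strict Implicit.
Unset Printing Implicit Defensive.

Local Open Scope classical_set_scope.
Local Open Scope ring_scope.

Definition is_max (R : realType) (A : set R) (m : R) : Prop :=
  A m /\ ubound A m.

Definition is_min (R : realType) (A : set R) (m : R) : Prop :=
  A m /\ lbound A m.

(* A complete normed space [X] with an inner product inducing its norm is a
   real Hilbert space. *)
Definition norm_of_dot (R : realType) (X : completeNormedModType R)
    (dot : {dot X for idfun}) : Prop :=
  forall x : X, `|x| = Num.sqrt (dot x x).

(* The gradient is the Riesz representative of the Fréchet derivative. *)
Definition is_gradient (R : realType) (X : completeNormedModType R)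
    (dot : {dot X for idfun}) (f : X -> R) (x v : X) : Prop :=
  differentiable f x /\ forall h : X, 'd f x h = dot h v.

Section Greedy.
Context (R : realType) (X : completeNormedModType R).
Variables (dot : {dot X for idfun}) (D : set X).
Variable grad : X -> X.

(* Valued in the extended reals: the supremum may be infinite. *)
Definition curvature (f : X -> R) : \bar R :=
  ereal_sup [set c | exists x s (a : R) y,
    [/\ D x, D s, 0 < a <= 1, y = x + a *: (s - x) &
        c = ((a ^+ 2)^-1 * (f y - f x - dot (y - x) (grad x)))%:E]].

(* [g] is the duality gap at [x]; being a maximum, it has to be attained. *)
Definition is_duality_gap (x : X) (g : R) : Prop :=
  is_max [set dot (x - y) (grad x) | y in D] g.

Definition exact_choice (x s : X) : Prop :=
  D s /\ is_min [set dot y (grad x) | y in D] (dot s (grad x)).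

Definition approx_choice (delta : R) (x s : X) : Prop :=
  D s /\ exists2 m, is_min [set dot y (grad x) | y in D] m &
                    dot s (grad x) <= m + delta.

(* [x 0, ..., x N] are the iterates of [N] iterations with step-sizes [alpha];
   [choice k] relates the current iterate to the admissible points [s] in
   iteration [k]. *)
Definition greedy_run (choice : nat -> X -> X -> Prop) (alpha : nat -> R)
    (N : nat) (x : nat -> X) : Prop :=
  D (x 0) /\
  forall k, (k < N)%N ->
    exists2 s, choice k (x k) s & x k.+1 = x k + alpha k *: (s - x k).

End Greedy.

Definition step_size (R : realType) (K k : nat) : R :=
  if (k <= K)%N then 2 / (k%:R + 2) else 2 / (K%:R + 2).

(* Main.v *)
Require Import Defs.
From mathcomp Require Import unstable ring lra zify.

(** Fix any comparison point y in D and let h k = f (x k) - f y.  Write g k for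
    the duality gap at x k, and B for C in the exact variant, 2 * C in the
    approximate one.  Everything follows from two inequalities.

    - One iteration with step a costs h (k+1) <= h k - a * g k + a^2 * B
      ([greedy_step_decrease]): the curvature bounds the error of the linear
      model by a^2 * C, the model itself decreases by a * g k, and an oracle
      error of a * C adds another a^2 * C.
    - h k <= g k ([primal_le_duality_gap]), since a convex function lies above
      its tangents.

    In the first K iterations the gap is replaced by h, which turns the first
    inequality into the recursion h (k+1) <= (1 - a) * h k + a^2 * B; with
    a = 2 / (k+2) this gives h K <= 4 * B / (K+2) ([open_loop_rate]).  In the
    next K+1 iterations the step is constant, so if all of their gaps exceeded
    eps, h would lose more than the 4 * B / (K+2) it still has and would become
    negative at the last iterate ([gap_reaches_eps]).  Choosing y to be that
    very iterate makes this absurd.  The gaps themselves are attained because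
    the oracle of each of these iterations exhibits a minimum of the linear
    functional.

    The rate needs one iteration to start with, so K = 0 is separate.  Then
    C = 0, the function is affine on D, and the single step of length 1 ends at
    a minimizer of f, where the gap is 0 ([zero_curvature_gap]). *)

Set Implicit Arguments.
Unset Strict Implicit.
Unset Printing Implicit Defensive.

Local Open Scope classical_set_scope.
Local Open Scope ring_scope.

(** * Real recursions satisfied by the primal error and the gap *)

(** The recursion h (k+1) <= (1 - a) * h k + a^2 * B forgets its initial value
    at once, because the first step has a = 1; hence the rate holds from k = 1
    on whatever h 0 is. *)
Lemma open_loop_rate (R : realType) (h g : nat -> R) (B : R) (K : nat) :
  0 <= B ->
  (forall k, (k < K)%N -> h k <= g k) ->
  (forall k, (k < K)%N ->
     h k.+1 <= h k - 2 / (k%:R + 2) * g k + (2 / (k%:R + 2)) ^+ 2 * B) ->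
  forall k, (0 < k <= K)%N -> h k <= 4 * B / (k%:R + 2).
Proof.
move=> B_ge0 hg hS; elim=> [//|k IH] /= kK.
have n_ge0 : 0 <= k%:R :> R by rewrite ler0n.
have a_ge0 : 0 <= 2 / (k%:R + 2) :> R by rewrite divr_ge0 ?addr_ge0.
have contract : h k.+1 <= k%:R / (k%:R + 2) * h k + (2 / (k%:R + 2)) ^+ 2 * B.
  apply: le_trans (hS k kK) _; rewrite lerD2r.
  have -> : k%:R / (k%:R + 2) * h k = h k - 2 / (k%:R + 2) * h k by field; lra.
  by rewrite lerD2l lerN2 ler_wpM2l ?hg.
apply: le_trans contract _.
have hk : k%:R / (k%:R + 2) * h k <= k%:R / (k%:R + 2) * (4 * B / (k%:R + 2)).
  (* For k = 0 there is no bound on h 0, but its coefficient vanishes. *)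
  case: k kK n_ge0 {hS} a_ge0 IH => [|k] kK n_ge0 _ IH; first by rewrite !mul0r.
  by rewrite ler_wpM2l ?divr_ge0 ?addr_ge0// IH// (ltnW kK).
apply: le_trans (lerD hk (lexx _)) _.
rewrite -subr_ge0 -[k.+1%:R]natr1.
have -> : 4 * B / (k%:R + 1 + 2) -
    (k%:R / (k%:R + 2) * (4 * B / (k%:R + 2)) + (2 / (k%:R + 2)) ^+ 2 * B)
   = 4 * B / ((k%:R + 3) * (k%:R + 2) ^+ 2) by field; lra.
by rewrite divr_ge0 ?mulr_ge0 ?exprn_ge0 ?addr_ge0.
Qed.

Lemma constant_step_decrease (R : realType) (h g : nat -> R) (a B eps : R)
    (K n : nat) :
  0 <= a ->
  (forall k, (K <= k < K + n)%N -> eps <= g k) ->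
  (forall k, (K <= k < K + n)%N -> h k.+1 <= h k - a * g k + a ^+ 2 * B) ->
  h (K + n)%N <= h K + n%:R * (a ^+ 2 * B - a * eps).
Proof.
move=> a_ge0; elim: n => [|n IH] gap_ge hS; first by rewrite addn0 mul0r addr0.
have inS k : (K <= k < K + n)%N -> (K <= k < K + n.+1)%N by lia.
have last : (K <= K + n < K + n.+1)%N by lia.
have {}IH := IH (fun k kn => gap_ge k (inS k kn)) (fun k kn => hS k (inS k kn)).
have := ler_wpM2l a_ge0 (gap_ge _ last).
have := hS _ last; rewrite -addnS -[n.+1%:R]natr1.
by lra.
Qed.

(** If the K+1 gaps all exceeded eps, the last value of h would be at most
    [4 * B / (K+2) + (K+1) * a * (a * B - eps)] with a = 2 / (K+2).  Replacing
    4 * B by its upper bound K * eps makes this a positive multiple of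
    K^2 + 2K + K(K+1) - 2(K+1)(K+2) = - 3K - 4. *)
Lemma gap_reaches_eps (R : realType) (h g : nat -> R) (B eps : R) (K : nat) :
  0 < eps -> 4 * B <= K%:R * eps ->
  h K <= 4 * B / (K%:R + 2) -> 0 <= h (K + K.+1)%N ->
  (forall k, (K <= k < K + K.+1)%N ->
     h k.+1 <= h k - 2 / (K%:R + 2) * g k + (2 / (K%:R + 2)) ^+ 2 * B) ->
  exists2 k, (K <= k < K + K.+1)%N & g k <= eps.
Proof.
move=> eps_gt0 BK hK hend hS; apply: contrapT => none.
have K_ge0 : 0 <= K%:R :> R by rewrite ler0n.
have gap_ge k : (K <= k < K + K.+1)%N -> eps <= g k.
  move=> kK; rewrite leNgt; apply/negP => gk.
  by apply: none; exists k => //; exact: ltW.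
have a_ge0 : 0 <= 2 / (K%:R + 2) :> R by rewrite divr_ge0 ?addr_ge0.
have := constant_step_decrease a_ge0 gap_ge hS.
rewrite leNgt => /negP; apply; apply: lt_le_trans hend.
apply: le_lt_trans (lerD hK (lexx _)) _.
rewrite -[K.+1%:R]natr1.
have -> : 4 * B / (K%:R + 2) +
    (K%:R + 1) * ((2 / (K%:R + 2)) ^+ 2 * B - 2 / (K%:R + 2) * eps)
  = ((2 * K%:R + 3) * (4 * B) - 2 * (K%:R + 1) * (K%:R + 2) * eps)
    / (K%:R + 2) ^+ 2 by field; lra.
rewrite pmulr_llt0 ?invr_gt0 ?exprn_gt0 ?ltr_wpDl//.
have p_ge0 : 0 <= 2 * K%:R + 3 :> R by lra.
have := ler_wpM2l p_ge0 BK.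
by nra.
Qed.

(** * Convexity, curvature and the duality gap *)

Section Greedy.
Context (R : realType) (X : completeNormedModType R).
Context (dot : {dot X for idfun}) (D : set X) (D_convex : convex_set D).
Context (f : X -> R) (f_convex : convex_function D f).
Context (grad : X -> X) (f_grad : forall x, D x -> is_gradient dot f x (grad x)).

Lemma convex_combE (x s : X) (a : R) :
  a *: s + (1 - a) *: x = x + a *: (s - x).
Proof. by rewrite scalerBl scale1r scalerBr addrCA. Qed.

Lemma convex_set_step (x s : X) (a : R) :
  0 <= a <= 1 -> D x -> D s -> D (x + a *: (s - x)).
Proof.
case/andP=> a0 a1 Dx Ds.
have := D_convex (Itv01 a0 a1) (mem_set Ds) (mem_set Dx).
by rewrite inE /conv/= /onem convex_combE.
Qed.

Lemma convex_function_step (x s : X) (a : R) :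
  0 <= a <= 1 -> D x -> D s -> f (x + a *: (s - x)) <= f x + a * (f s - f x).
Proof.
case/andP=> a0 a1 Dx Ds; rewrite -convex_combE.
have := f_convex (Itv01 a0 a1) (mem_set Ds) (mem_set Dx).
move=> /le_trans; apply; rewrite convRE /onem/=; lra.
Qed.

(** The derivative in the direction y - x is a limit of right difference
    quotients, each of which is at most f y - f x by convexity. *)
Lemma convex_above_tangent (x y : X) :
  D x -> D y -> f x + dot (y - x) (grad x) <= f y.
Proof.
move=> Dx Dy; have [df fE] := f_grad Dx.
rewrite -fE -deriveE// -lerBrDl.
have dq := cvg_dnbhs_at_right (diff_derivable (v := y - x) df).
apply: (cvgr_to_le dq); near=> t => /=.
have t_gt0 : 0 < t by [].
have t_le1 : t <= 1 by near: t; exact: nbhs_right_le.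
have t01 : 0 <= t <= 1 by rewrite t_le1 (ltW t_gt0).
have := convex_function_step t01 Dx Dy; rewrite addrC => ft.
by rewrite /GRing.scale/= ler_pdivrMl// lerBlDl.
Unshelve. all: by end_near. Qed.

Context (C : R) (hC : curvature dot D grad f = C%:E).

Lemma curvature_ub (x s : X) (a : R) : D x -> D s -> 0 < a <= 1 ->
  f (x + a *: (s - x)) <= f x + a * dot (s - x) (grad x) + a ^+ 2 * C.
Proof.
move=> Dx Ds a01; have a_gt0 : 0 < a by case/andP: a01.
pose y := x + a *: (s - x).
have : (((a ^+ 2)^-1 * (f y - f x - dot (y - x) (grad x)))%:E <= C%:E)%E.
  by rewrite -hC; apply: ereal_sup_ubound; exists x, s, a, y.
rewrite lee_fin ler_pdivrMl ?exprn_gt0// !lerBlDr.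
have -> : dot (y - x) (grad x) = a * dot (s - x) (grad x).
  by rewrite /y addrAC subrr add0r linearZl_LR.
lra.
Qed.

(** The choice s = x contributes the value 0 to the supremum. *)
Lemma curvature_ge0 : D !=set0 -> 0 <= C.
Proof.
move=> [x Dx]; rewrite -lee_fin -hC; apply: ereal_sup_ubound.
exists x, x, 1, x; split=> //; first by rewrite ltr01 lexx.
  by rewrite subrr scaler0 addr0.
by rewrite !subrr linear0l subrr mulr0.
Qed.

(** Why the gap is a genuine maximum at every iterate from which an iteration
    starts: minimizing the linear functional is what the oracle does. *)
Lemma duality_gap_of_min (x : X) (m : R) :
  is_min [set dot y (grad x) | y in D] m ->
  is_duality_gap dot D grad x (dot x (grad x) - m).
Proof.
move=> [[s Ds sE] m_lb]; split; first by exists s; rewrite // linearBl /= sE.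
move=> _ [y Dy <-]; rewrite linearBl /= lerD2l lerN2.
by apply: m_lb; exists y.
Qed.

Lemma primal_le_duality_gap (x y : X) (g : R) :
  is_duality_gap dot D grad x g -> D x -> D y -> f x - f y <= g.
Proof.
move=> [_ g_ub] Dx Dy; apply: le_trans (g_ub _ (ex_intro2 _ _ y Dy erefl)).
have := convex_above_tangent Dx Dy; rewrite -opprB linearNl/=; lra.
Qed.

(** The oracle error a * E is proportional to the step, so after multiplication
    by a it has the same order a^2 as the curvature term.  E = 0 is the exact
    oracle and E = C the approximate one. *)
Lemma greedy_step_decrease (x s : X) (a E : R) :
  D x -> 0 < a <= 1 -> approx_choice dot D grad (a * E) x s ->
  exists2 g, is_duality_gap dot D grad x g &
    f (x + a *: (s - x)) <= f x - a * g + a ^+ 2 * (C + E).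
Proof.
move=> Dx a01 [Ds [m m_min sm]]; have a_gt0 : 0 < a by case/andP: a01.
exists (dot x (grad x) - m); first exact: duality_gap_of_min.
apply: le_trans (curvature_ub Dx Ds a01) _; rewrite linearBl/=.
have := ler_wpM2l (ltW a_gt0) sm; lra.
Qed.

(** * Runs of the algorithm *)

Lemma step_size_gt0_le1 (K k : nat) : 0 < step_size R K k <= 1.
Proof.
by rewrite /step_size; case: ifP => _;
  rewrite divr_gt0 ?ltr_wpDl//= ler_pdivrMr ?ltr_wpDl// mul1r lerDr.
Qed.

Lemma greedy_run_in (choice : nat -> X -> X -> Prop) (K N : nat) (x : nat -> X) :
  (forall k y s, choice k y s -> D s) ->
  greedy_run D choice (step_size R K) N x ->
  forall k, (k <= N)%N -> D (x k).
Proof.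
move=> choiceD [Dx0 run]; elim=> [//|k IH] kN.
have [s /choiceD Ds ->] := run k kN.
have /andP[a_gt0 a_le1] := step_size_gt0_le1 K k.
by apply: convex_set_step; rewrite ?(ltW a_gt0)//; exact/IH/ltnW.
Qed.

(** With no curvature f lies below its tangents on D as well, so the gap at x is
    at most f x - f y for some y, which is not positive at a minimizer. *)
Lemma zero_curvature_gap (x : X) :
  C <= 0 -> D x -> (forall y, D y -> f x <= f y) ->
  is_duality_gap dot D grad x 0.
Proof.
move=> C_le0 Dx x_min; split; first by exists x; rewrite // subrr linear0l.
move=> _ [y Dy <-].
have := @curvature_ub x y 1 Dx Dy; rewrite ltr01 lexx => /(_ isT).
rewrite scale1r addrC subrK -opprB linearNl.
have := x_min y Dy; rewrite expr1n mul1r; lra.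
Qed.

(** The oracle errors act like additional curvature E, which is why the
    approximate variant, with E = C, asks for twice as large a K as the exact
    one, with E = 0. *)
Lemma greedy_small_gap (E eps : R) (K : nat) (x : nat -> X) :
  0 <= E -> 0 < eps -> 4 * (C + E) <= K%:R * eps ->
  greedy_run D (fun k => approx_choice dot D grad (step_size R K k * E))
    (step_size R K) (K + K.+1) x ->
  exists k : nat, (K <= k <= 2 * K + 1)%N /\
    exists2 g : R, is_duality_gap dot D grad (x k) g & g <= eps.
Proof.
move=> E_ge0 eps_gt0 BK run.
have Dx : forall k, (k <= K + K.+1)%N -> D (x k).
  by apply: greedy_run_in run => k y s [].
have C_ge0 : 0 <= C by apply: curvature_ge0; exists (x 0); exact: Dx.
have /choice[g g_step] : forall k, exists g, (k < K + K.+1)%N ->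
    is_duality_gap dot D grad (x k) g /\
    f (x k.+1) <= f (x k) - step_size R K k * g + step_size R K k ^+ 2 * (C + E).
  move=> k; have [kN|//] := boolP (k < K + K.+1)%N; last by exists 0.
  have [s choose_s ->] := run.2 k kN.
  have [g gap_g g_dec] :=
    greedy_step_decrease (Dx k (ltnW kN)) (step_size_gt0_le1 K k) choose_s.
  by exists g.
have gap_h y k : D y -> (k < K + K.+1)%N -> f (x k) - f y <= g k.
  move=> Dy kN; apply: primal_le_duality_gap Dy; last exact/Dx/ltnW.
  exact: (g_step k kN).1.
have step_h y k : (k < K + K.+1)%N -> f (x k.+1) - f y <= f (x k) - f y
    - step_size R K k * g k + step_size R K k ^+ 2 * (C + E).
  by move=> kN; have := (g_step k kN).2; lra.
have small k : (K <= k < K + K.+1)%N -> g k <= eps ->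
    exists k : nat, (K <= k <= 2 * K + 1)%N /\
      exists2 g : R, is_duality_gap dot D grad (x k) g & g <= eps.
  move=> kK gk; exists k; split; first lia.
  by exists (g k) => //; apply: (g_step k _).1; case/andP: kK.
have [K0|K_gt0] := posnP K.
  (* C = E = 0 and the only step has length 1: f (x 1) - f y is at most
     (1 - 1) * (f (x 0) - f y), for every y in D. *)
  subst K; exists 1%N; split=> //; exists 0; last exact: ltW.
  have C0 : C <= 0 by move: BK; rewrite mul0r; lra.
  have E0 : E <= 0 by move: BK; rewrite mul0r; lra.
  apply: zero_curvature_gap => // [|y Dy]; first exact: Dx.
  have := step_h y 0%N isT; have := gap_h y 0%N Dy isT.
  by rewrite /step_size/= add0r divff// expr1n; lra.
(* Comparing with the last iterate makes the final value of h equal to 0. *)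
pose z := x (K + K.+1)%N; have Dz : D z by exact: Dx.
have rate : f (x K) - f z <= 4 * (C + E) / (K%:R + 2).
  apply: (open_loop_rate (h := fun k => f (x k) - f z) (g := g) (K := K)).
  - exact: addr_ge0.
  - by move=> k kK; apply: gap_h => //; lia.
  - move=> k kK; have := step_h z k; rewrite /step_size (ltnW kK); apply; lia.
  - by rewrite K_gt0 leqnn.
have [||k kK gk] := gap_reaches_eps (h := fun k => f (x k) - f z) (g := g)
  eps_gt0 BK rate; last exact: small kK gk.
  by rewrite subrr.
move=> k kK; have := step_h z k; rewrite /step_size.
have -> : (if (k <= K)%N then 2 / (k%:R + 2) else 2 / (K%:R + 2)) =
          2 / (K%:R + 2) :> R.
  (* The two prescriptions agree at k = K. *)
  by case: leqP => // kK'; have -> : k = K by lia.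
by apply; case/andP: kK.
Qed.

End Greedy.

Lemma ceil_step_budget (R : realType) (c eps : R) (K : nat) :
  0 < eps -> K%:Z = Num.ceil (c / eps) -> c <= K%:R * eps.
Proof.
move=> eps_gt0 KE; rewrite -ler_pdivrMr//.
by have := ceil_ge (c / eps); rewrite -KE.
Qed.

Theorem theorem5 (R : realType) (X : completeNormedModType R)
    (dot : {dot X for idfun}) (hdot : norm_of_dot dot)
    (D : set X) (D_nonempty : D !=set0) (D_closed : closed D)
    (D_bounded : bounded_set D) (D_convex : convex_set D)
    (f : X -> R) (f_convex : convex_function D f)
    (grad : X -> X) (f_grad : forall x, D x -> is_gradient dot f x (grad x))
    (C : R) (hC : curvature dot D grad f = C%:E)
    (eps : R) (eps_gt0 : 0 < eps) :
  (forall (K : nat) (x : nat -> X),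
     K%:Z = Num.ceil (4 * C / eps) ->
     greedy_run D (fun=> exact_choice dot D grad) (step_size R K)
       (K + K.+1) x ->
     exists k : nat, (K <= k <= 2 * K + 1)%N /\
       exists2 g : R, is_duality_gap dot D grad (x k) g & g <= eps)
  /\
  (forall (K : nat) (x : nat -> X),
     K%:Z = Num.ceil (8 * C / eps) ->
     greedy_run D (fun k => approx_choice dot D grad (step_size R K k * C))
       (step_size R K) (K + K.+1) x ->
     exists k : nat, (K <= k <= 2 * K + 1)%N /\
       exists2 g : R, is_duality_gap dot D grad (x k) g & g <= eps).
Proof.
have C_ge0 := curvature_ge0 hC D_nonempty.
split=> K x /(ceil_step_budget eps_gt0) KE run.
  apply: (greedy_small_gap D_convex f_convex f_grad hC (lexx 0) eps_gt0).
    by rewrite addr0.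
  split=> [|k kN]; first exact: run.1.
  have [s [Ds s_min] xE] := run.2 k kN; exists s => //; split=> //.
  by exists (dot s (grad (x k))); rewrite // mulr0 addr0.
apply: (greedy_small_gap D_convex f_convex f_grad hC C_ge0 eps_gt0) run.
by apply: le_trans KE; lra.
Qed.
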